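(* Let $a,b$ be relatively prime integers with $2\le a<b$. Then the number of exceptional values with respect to $a$ and $b$ is exactly $\frac{(a-3)(b-1)}{2}+\left\lfloor \frac{b}{a}\right\rfloor$.
   Context: For relatively prime positive integers $a_1,\dots,a_n$ (each at least 2), the Frobenius number $g(a_1,\dots,a_n)$ is the largest integer not representable as a nonnegative integer linear combination of $a_1,\dots,a_n$. Given relatively prime $a<b$, an integer $c>b$ (with $a,b,c$ relatively prime) is called an exceptional value with respect to $a$ and $b$ if $g(a,b,c)<g(a,b)$. *)

(* Defs.v *)
From mathcomp Require Import all_boot all_order all_algebra.
From mathcomp Require Import finmap.
From mathcomp Require Import boolp classical_sets cardinality.

Set Implicit Arguments.
Unset Strict Implicit.
Unset Printing Implicit Defensive.

Import Order.TTheory GRing.Theory Num.Theory.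

Local Open Scope classical_set_scope.
Local Open Scope ring_scope.

Definition representable (s : seq nat) (m : int) : Prop :=
  exists k : nat -> nat, m = (\sum_(i < size s) k i * nth 0 s i)%N%:Z.

Definition is_frobenius (s : seq nat) (g : int) : Prop :=
  ~ representable s g /\ forall m : int, ~ representable s m -> m <= g.

(* The default value 0 is only used when no largest non-representable integer
   exists (e.g. when the gcd of [s] is not 1). *)
Definition frobenius (s : seq nat) : int :=
  xget 0 [set g : int | is_frobenius s g].

Lemma is_frobenius_inj (s : seq nat) (g h : int) :
  is_frobenius s g -> is_frobenius s h -> g = h.
Proof.
by move=> [ng maxg] [nh maxh]; apply/le_anti; rewrite maxh // maxg.
Qed.

Lemma frobeniusE (s : seq nat) (g : int) : is_frobenius s g -> frobenius s = g.
Proof.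
move=> fg; rewrite /frobenius.
by apply: (is_frobenius_inj _ fg); apply: (xgetPex 0 (P := is_frobenius s)); exists g.
Qed.

Definition exceptional (a b c : nat) : Prop :=
  [/\ (b < c)%N, gcdn (gcdn a b) c = 1%N
    & frobenius [:: a; b; c] < frobenius [:: a; b]].

(* Main.v *)
Require Import Defs.
From mathcomp Require Import all_boot all_order all_algebra.
From mathcomp Require Import finmap.
From mathcomp Require Import boolp classical_sets cardinality.
From mathcomp Require Import zify ring lra.

Import Order.TTheory GRing.Theory Num.Theory.

(** Put G = ab - a - b = g(a,b).  Exactly one of n and G - n is representable
by a and b.  Hence G becomes representable once c is added, i.e. G - zc is
representable by a and b for some z >= 1, iff some multiple zc is not
representable, iff c itself is not.  So the exceptional values are the
non-representable c > b.  The symmetry n <-> G - n shows that there are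
(a-1)(b-1)/2 non-representable naturals; those up to b are the numbers below b
which are not multiples of a, of which there are b - 1 - floor(b/a). *)

Definition nat_rep (a b n : nat) : Prop :=
  exists x y : nat, n = (x * a + y * b)%N.

Lemma representable2P (a b : nat) (m : int) :
  representable [:: a; b] m <-> exists2 n, m = Posz n & nat_rep a b n.
Proof.
split=> [[k ->]|[n -> [x [y ->]]]].
  by eexists; [reflexivity | exists (k 0), (k 1); rewrite !big_ord_recl big_ord0 addn0].
by exists (fun i => if i is 0 then x else y); rewrite !big_ord_recl big_ord0 addn0.
Qed.

Lemma representable3P (a b c : nat) (m : int) :
  representable [:: a; b; c] m <->
  exists n z, m = Posz (n + z * c) /\ nat_rep a b n.
Proof.
split=> [[k ->]|[n [z [-> [x [y ->]]]]]].
  exists (k 0 * a + k 1 * b)%N, (k 2); split; last by exists (k 0), (k 1).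
  by rewrite !big_ord_recl big_ord0 addn0 addnA.
exists (fun i => if i is i'.+1 then if i' is 0 then y else z else x).
by rewrite !big_ord_recl big_ord0 addn0 addnA.
Qed.

Section CoprimePair.

Variables (a b : nat).
Hypotheses (a_gt0 : 0 < a) (b_gt0 : 0 < b) (co_ab : coprime a b).

Lemma nat_repM (n z : nat) : nat_rep a b n -> nat_rep a b (z * n).
Proof. by move=> [x [y ->]]; exists (z * x), (z * y); ring. Qed.

(** Since [b] is invertible mod [a], some residue [y] satisfies [y * b = n] mod [a]. Then
    [n - y * b] is a multiple of [a], and its sign decides between the two cases. *)
Lemma nat_rep_canonical (n : nat) :
  exists2 y, y < a & nat_rep a b n \/ exists k, y * b = n + k.+1 * a.
Proof.
(* The Chinese remainder is congruent to [n] mod [a] and divisible by [b]. *)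
pose y := chinese a b n 0 %/ b %% a.
have yE : y * b = n %[mod a].
  rewrite /y modnMml divnK ?chinese_modl //.
  by rewrite /dvdn (chinese_modr co_ab) mod0n.
exists y; first by rewrite ltn_mod.
have [le_yn|lt_ny] := leqP (y * b) n.
  left; have : a %| n - y * b by rewrite -eqn_mod_dvd // yE.
  by move=> /dvdnP[x xE]; exists x, y; lia.
right; have : a %| y * b - n by rewrite -eqn_mod_dvd ?yE // ltnW.
by move=> /dvdnP[[|k] kE]; [lia | exists k; lia].
Qed.

(** Otherwise [n + a <= y * b <= (a - 1) * b], which puts [n] at or below G. *)
Lemma nat_rep_large (n : nat) : a * b < n + a + b -> nat_rep a b n.
Proof.
move=> lt_n; have [y lt_ya [//|[k yE]]] := nat_rep_canonical n.
have : y.+1 * b <= a * b by rewrite leq_mul2r lt_ya orbT.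
by nia.
Qed.

Lemma nat_rep_sym (m n : nat) :
  m + n + a + b = a * b -> nat_rep a b m <-> ~ nat_rep a b n.
Proof.
move=> mnE; split=> [[x [y xyE]] [x' [y' xyE']]|nrep_n].
  (* Both coefficients are positive. As [b] divides the first, the term in [a] alone reaches
     [a * b], leaving no room for the other. *)
  have sumE : (x + x').+1 * a + (y + y').+1 * b = a * b by rewrite -mnE xyE xyE'; ring.
  have : b %| (x + x').+1 * a.
    by rewrite -(dvdn_addl _ (dvdn_mull (y + y').+1 (dvdnn b))) sumE dvdn_mull.
  rewrite Gauss_dvdl 1?coprime_sym // => /dvdn_leq-/(_ isT) le_b.
  have : a * b <= (x + x').+1 * a by rewrite mulnC leq_mul2r le_b orbT.
  by nia.
have [y lt_ya [//|[k yE]]] := nat_rep_canonical n.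
(* From [y * b = n + k.+1 * a], the mirror G - n equals [k * a + (a - 1 - y) * b]. *)
exists k, (a - y.+1).
have : (a - y.+1) * b + y.+1 * b = a * b by rewrite -mulnDl subnK.
by nia.
Qed.

Hypotheses (a_gt1 : 1 < a) (b_gt1 : 1 < b).

Lemma frobenius_number_ge0 : a + b <= a * b.
Proof. by nia. Qed.

Lemma nat_rep_frobenius_number : ~ nat_rep a b (a * b - a - b).
Proof.
have leG := frobenius_number_ge0.
have sumE : 0 + (a * b - a - b) + a + b = a * b by lia.
by apply/(nat_rep_sym _ _ sumE); exists 0, 0.
Qed.

Lemma is_frobenius2 : is_frobenius [:: a; b] (Posz (a * b - a - b)).
Proof.
have leG := frobenius_number_ge0.
split=> [/representable2P[n [<-]]|m nrep_m]; first exact: nat_rep_frobenius_number.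
case: m nrep_m => [m|m] // nrep_m; rewrite lez_nat leqNgt; apply/negP => lt_m.
apply: nrep_m; apply/representable2P; exists m => //.
by apply: nat_rep_large; lia.
Qed.

Lemma representable3_large (c : nat) (m : int) :
  ((Posz (a * b - a - b)) < m)%R -> representable [:: a; b; c] m.
Proof.
case: m => [m|m] //; rewrite ltz_nat => lt_m.
apply/representable3P; exists m, 0; rewrite mul0n addn0; split=> //.
by apply: nat_rep_large; have := frobenius_number_ge0; lia.
Qed.

(* Descend from G: the descent stops at -1 at the latest, which is the Frobenius
   number when every natural number is representable (c = 1). *)
Lemma is_frobenius3_ex (c : nat) : exists g, is_frobenius [:: a; b; c] g.
Proof.
suff H (n : nat) :
    (forall m : int, (Posz n <= m)%R -> representable [:: a; b; c] m) ->
    exists g, is_frobenius [:: a; b; c] g.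
  by apply: (H (a * b - a - b).+1) => m le_m; apply: representable3_large; lia.
elim: n => [|n IHn] rep_n.
  exists (-1)%R; split=> [/representable3P[n [z []]] //|m nrep_m].
  by case: (lerP m (-1)) => // lt_m; case: nrep_m; apply: rep_n; lia.
have [rep|nrep] := pselect (representable [:: a; b; c] (Posz n)).
  apply: IHn => m; rewrite le_eqVlt => /orP[/eqP <- //|lt_m].
  by apply: rep_n; lia.
exists (Posz n); split=> // m nrep_m.
by case: (lerP m n) => // lt_m; case: nrep_m; apply: rep_n; lia.
Qed.

(** All integers above G are representable, so g(a,b,c) is at most G, with equality exactly when G
    stays non-representable. *)
Lemma frobenius3_lt (c : nat) :
  (frobenius [:: a; b; c] < frobenius [:: a; b])%R <->
  representable [:: a; b; c] (Posz (a * b - a - b)).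
Proof.
rewrite (frobeniusE is_frobenius2).
have [g fg] := is_frobenius3_ex c; rewrite (frobeniusE fg); case: fg => nrep_g max_g.
split=> [lt_g|repG].
  by apply: contrapT => /max_g; rewrite leNgt lt_g.
rewrite lt_neqAle; apply/andP; split; first by apply/eqP => gE; rewrite gE in nrep_g.
by rewrite leNgt; apply/negP => lt_g; exact/nrep_g/representable3_large.
Qed.

Lemma representable3_frobenius (c : nat) :
  representable [:: a; b; c] (Posz (a * b - a - b)) <-> ~ nat_rep a b c.
Proof.
have leG := frobenius_number_ge0; split.
  move=> /representable3P[n [z [[GE] rep_n]]] /(nat_repM _ z).
  have sumE : n + z * c + a + b = a * b by lia.
  exact/(nat_rep_sym _ _ sumE).
move=> nrep_c; apply/representable3P.
(* This keeps the subtraction G - c below from truncating. *)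
have le_c : c <= a * b - a - b.
  by rewrite leqNgt; apply/negP => lt_c; apply: nrep_c; apply: nat_rep_large; lia.
exists (a * b - a - b - c), 1; split; first by rewrite mul1n subnK.
have sumE : a * b - a - b - c + c + a + b = a * b by lia.
exact/(nat_rep_sym _ _ sumE).
Qed.

Lemma exceptionalE (c : nat) : exceptional a b c <-> b < c /\ ~ nat_rep a b c.
Proof.
split=> [[lt_bc _ /frobenius3_lt/representable3_frobenius]|[lt_bc nrep_c]] //.
split=> //; last exact/frobenius3_lt/representable3_frobenius.
by rewrite (eqP co_ab) gcd1n.
Qed.

Lemma double_sum_not_nat_rep :
  (\sum_(0 <= i < a * b) ~~ `[< nat_rep a b i >]).*2 = (a - 1) * (b - 1).
Proof.
have leG := frobenius_number_ge0.
(* Here M = G + 1, so the indices from M on are all representable and contribute 0. *)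
have ME : (a - 1) * (b - 1) + a + b = (a * b).+1 by nia.
set M := (a - 1) * (b - 1) in ME *.
rewrite (big_cat_nat (n := M)) //=; last by lia.
rewrite [X in _ + X]big_nat_cond [X in _ + X]big1 ?addn0; last first.
  move=> i /andP[/andP[le_i _] _]; apply/eqP; rewrite eqb0 negbK.
  by apply/asboolP/nat_rep_large; lia.
(* One copy of the sum is reversed by i -> M - 1 - i = G - i; each mirrored pair then contributes
   exactly 1. *)
rewrite big_mkord -addnn {1}(reindex_inj rev_ord_inj) -big_split /=.
rewrite (eq_bigr (fun=> 1)) ?sum1_card ?card_ord // => i _.
have lt_iM := ltn_ord i.
have sumE : M - i.+1 + i + a + b = a * b by lia.
rewrite (asbool_equiv_eq (nat_rep_sym _ _ sumE)) asbool_neg negbK.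
by case: asbool.
Qed.

End CoprimePair.

Lemma sum_not_nat_rep_le (a b : nat) : 1 < a < b -> coprime a b ->
  \sum_(0 <= i < b.+1) ~~ `[< nat_rep a b i >] + b %/ a + 1 = b.
Proof.
move=> /andP[a_gt1 lt_ab] co_ab.
have b_gt0 : 0 < b by lia.
(* Below [b] no copy of [b] fits. *)
have rep_lt i : i < b -> `[< nat_rep a b i >] = (a %| i).
  move=> lt_i; apply/asboolP/dvdnP => [[x [[|y] iE]]|[x ->]].
  - by exists x; rewrite iE addn0.
  - by move: lt_i; rewrite iE mulSn ltnNge addnCA leq_addr.
  - by exists x, 0; rewrite addn0.
rewrite big_nat_recr //= big_ltn // rep_lt // dvdn0 add0n.
have -> : `[< nat_rep a b b >] by apply/asboolP; exists 0, 1; rewrite mul1n.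
(* The floor counts the multiples of [a] in 1..b, and [b] is not one; each index in 1..b-1 is thus
   counted once, by one of the two sums. *)
rewrite addn0 divn_count_dvd big_nat_recr //=.
have -> : (a %| b) = false.
  by apply/negP => /gcdn_idPl; rewrite (eqP co_ab) => aE; rewrite -aE in a_gt1.
rewrite addn0 -big_split /= big_nat (eq_bigr (fun=> 1)); last first.
  by move=> i /andP[_ lt_i]; rewrite rep_lt //; case: (a %| i).
by rewrite -big_nat sum_nat_const_nat muln1 subnK.
Qed.

Local Open Scope classical_set_scope.
Local Open Scope ring_scope.

Theorem theorem4 (a b : nat) (a_ge2 : (2 <= a)%N) (lt_ab : (a < b)%N)
    (co_ab : coprime a b) :
  finite_set [set c : nat | exceptional a b c] /\
  (#|` fset_set [set c : nat | exceptional a b c]|%fset)%:R =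
    (a%:R - 3) * (b%:R - 1) / 2 + (b %/ a)%N%:R :> rat.
Proof.
have a_gt0 : (0 < a)%N by lia.
have b_gt0 : (0 < b)%N by lia.
have b_gt1 : (1 < b)%N by lia.
pose nrep i := ~~ `[< nat_rep a b i >].
pose s := [seq c <- index_iota b.+1 (a * b) | nrep c].
have -> : [set c | exceptional a b c] = [set` [fset c in s]%fset].
  apply/seteqP; split=> c /=; rewrite !inE /= mem_filter mem_index_iota.
    move=> /(exceptionalE _ _ a_gt0 b_gt0 co_ab a_ge2 b_gt1)[lt_bc nrep_c].
    rewrite lt_bc /nrep; apply/andP; split; first exact/asboolPn.
    rewrite ltnNge; apply/negP => le_c; apply: nrep_c.
    by apply: nat_rep_large => //; lia.
  move=> /andP[/asboolPn nrep_c /andP[lt_bc _]].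
  exact/(exceptionalE _ _ a_gt0 b_gt0 co_ab a_ge2 b_gt1).
split; first exact: finite_fset.
rewrite set_fsetK card_fseq undup_id ?filter_uniq ?iota_uniq // size_filter.
have := double_sum_not_nat_rep _ _ a_gt0 b_gt0 co_ab a_ge2 b_gt1.
have := sum_not_nat_rep_le a b; rewrite a_ge2 lt_ab => /(_ isT co_ab).
rewrite [X in _ -> X.*2 = _ -> _](big_cat_nat (n := b.+1)) //=; last by nia.
rewrite -/nrep; set S := (X in (X + _ + _)%N = _ -> _).
have -> : (\sum_(b.+1 <= i < a * b) nrep i)%N = count nrep (index_iota b.+1 (a * b)).
  by rewrite -sum1_count [RHS]big_mkcond.
set T := count _ _ => SE STE.
(* The equations move to [rat] because a - 3 is negative for a = 2. Eliminating [S] uses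
   (a-1)(b-1)/2 - (b-1) = (a-3)(b-1)/2. *)
have SEQ : S%:R + (b %/ a)%:R + 1 = b%:R :> rat by rewrite -[in RHS]SE !natrD.
have : (S%:R + T%:R) * 2 = (a%:R - 1) * (b%:R - 1) :> rat.
  by rewrite -natrD -natrM muln2 STE natrM !natrB.
lra.
Qed.
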